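(* Let $\mathbf{H}\in\mathbb{H}^4$. The following are equivalent: (1) $\mathbf{Cov}_2(\mathbf{H})$ is isotropic; (2) $\mathbf{H}$ is either cubic (when $\mathbf{d}_2\neq0$) or isotropic (when $\mathbf{d}_2=0$); (3) $\mathbf{d}_2$ is isotropic.
   Context: $\mathbb{H}^4$ is the space of totally symmetric traceless fourth-order tensors on $\mathbb{R}^3$, with $SO(3)$-action $(g\star\mathbf{T})(x_1,\dots,x_n)=\mathbf{T}(g^{-1}x_1,\dots,g^{-1}x_n)$. $\mathbf{Cov}_2(\mathbf{H})\subset\mathrm{Sym}^2(\mathbb{R}^3)$ is the set of values at $\mathbf{H}$ of all $SO(3)$-equivariant polynomial maps $\mathbb{H}^4\to\mathrm{Sym}^2(\mathbb{R}^3)$. $(\mathbf{H}:\mathbf{H})_{ijkl}=H_{ijmn}H_{mnkl}$, $(\operatorname{tr}_{13}\mathbf{A})_{ij}=A_{kikj}$, $\mathbf{d}_2=\operatorname{tr}_{13}(\mathbf{H}:\mathbf{H})$. Symmetry group of a tensor: $\{g\in SO(3):g\star\mathbf{T}=\mathbf{T}\}$; of a family (or subspace): intersection of its members' groups; symmetry class: conjugacy class in $SO(3)$. Isotropic means class $[SO(3)]$; cubic means class $[\mathbb{O}]$, $\mathbb{O}$ the orientation-preserving symmetry group of a cube (order 24). *)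

(* Defs.v *)
From HB Require Import structures.
From mathcomp Require Import all_boot all_order all_algebra.
From mathcomp Require Import classical_sets reals.
Set Implicit Arguments. Unset Strict Implicit. Unset Printing Implicit Defensive.
Import Order.TTheory GRing.Theory Num.Theory.
Local Open Scope ring_scope.
Local Open Scope classical_set_scope.

Section Defs.
Variable R : realType.

Definition tensor4 := 'I_3 -> 'I_3 -> 'I_3 -> 'I_3 -> R.

(* totally symmetric: invariant under the adjacent transpositions of indices,
   which generate S_4 *)
Definition totally_symmetric (T : tensor4) : Prop :=
  forall i j k l, T i j k l = T j i k l /\ T i j k l = T i k j l /\
                  T i j k l = T i j l k.

(* traceless: every contraction vanishes (by symmetry, one suffices) *)
Definition traceless (T : tensor4) : Prop :=
  forall k l, \sum_(i < 3) T i i k l = 0.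

Definition H4 : set tensor4 := [set T | totally_symmetric T /\ traceless T].

Definition Sym2 : set 'M[R]_3 := [set S | S^T = S].

Definition SO3 : set 'M[R]_3 := [set g | g *m g^T = 1%:M /\ \det g = 1].

(* (g * T)(x1,..,x4) = T(g^-1 x1, .., g^-1 x4), in components *)
Definition act4 (g : 'M[R]_3) (T : tensor4) : tensor4 :=
  fun i j k l => \sum_(a < 3) \sum_(b < 3) \sum_(c < 3) \sum_(d < 3)
                   g i a * g j b * g k c * g l d * T a b c d.

(* (g * S)(x,y) = S(g^-1 x, g^-1 y), i.e. g S g^T for g orthogonal *)
Definition act2 (g : 'M[R]_3) (S : 'M[R]_3) : 'M[R]_3 := g *m S *m g^T.

Inductive polyfun : (tensor4 -> R) -> Prop :=
| pf_const (c : R) : polyfun (fun _ => c)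
| pf_coord i j k l : polyfun (fun T => T i j k l)
| pf_add f h : polyfun f -> polyfun h -> polyfun (fun T => f T + h T)
| pf_mul f h : polyfun f -> polyfun h -> polyfun (fun T => f T * h T).

Definition equivariant_poly_map (f : tensor4 -> 'M[R]_3) : Prop :=
  [/\ forall i j, polyfun (fun T => f T i j),
      forall T, H4 T -> Sym2 (f T) &
      forall g T, SO3 g -> H4 T -> f (act4 g T) = act2 g (f T)].

Definition Cov2 (H : tensor4) : set 'M[R]_3 :=
  [set S | exists f, equivariant_poly_map f /\ S = f H].

Definition symgroup4 (T : tensor4) : set 'M[R]_3 :=
  [set g | SO3 g /\ act4 g T = T].
Definition symgroup2_family (F : set 'M[R]_3) : set 'M[R]_3 :=
  [set g | SO3 g /\ forall S, F S -> act2 g S = S].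
Definition symgroup2 (S : 'M[R]_3) : set 'M[R]_3 := symgroup2_family [set S].

Definition has_class (G K : set 'M[R]_3) : Prop :=
  exists2 g, SO3 g & G = [set g *m k *m g^T | k in K].

Definition is_vertex (v : 'cV[R]_3) : Prop := forall i, v i 0 = 1 \/ v i 0 = -1.
Definition cube_rotations : set 'M[R]_3 :=
  [set g | SO3 g /\ forall v, is_vertex v -> is_vertex (g *m v)].

Definition isotropic (G : set 'M[R]_3) : Prop := has_class G SO3.
Definition cubic (G : set 'M[R]_3) : Prop := has_class G cube_rotations.

Definition ddot (A B : tensor4) : tensor4 :=
  fun i j k l => \sum_(m < 3) \sum_(n < 3) A i j m n * B m n k l.

Definition tr13 (A : tensor4) : 'M[R]_3 := \matrix_(i, j) \sum_(k < 3) A k i k j.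

Definition d2 (H : tensor4) : 'M[R]_3 := tr13 (ddot H H).

End Defs.

(* Main.v *)
Require Import Defs.
From HB Require Import structures.
From mathcomp Require Import all_boot all_order all_algebra.
From mathcomp Require Import classical_sets reals boolp complex ring lra.
Set Implicit Arguments. Unset Strict Implicit. Unset Printing Implicit Defensive.
Import Order.TTheory GRing.Theory Num.Theory.
Local Open Scope ring_scope.
Local Open Scope classical_set_scope.

(* The symmetric matrices fixed by a conjugate of the cube group are scalar, which gives
   (2) => (1), and d_2 is itself an equivariant polynomial map, which gives (1) => (3).

   For (3) => (2), suppose d_2 is scalar.  The fundamental theorem of algebra yields a
   nonzero complex vector z with z.z = 0 and H(z,z,z,z) = 0; rotate so that z is
   proportional to e_1 + i e_2.  Then the components of H of weight +-4 under rotations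
   about e_3 vanish.  Writing t, r, q, p for the components of weight 0, 1, 2, 3, the
   deviatoric part of d_2 vanishes iff
     12 p r^* + 15 q t = 5 r^2,   5 p q^* + 9/4 q r^* + 5/8 r t = 0,
     |p|^2 = |q|^2 + 17/16 |r|^2 + 25/32 t^2,
   and comparing moduli forces q = r = 0 and |p|^2 = 25/32 t^2.  After a further rotation
   about e_3 (a complex cube root fixes the phase of p) this is a multiple of the harmonic
   part of x^4 + y^4 + z^4, seen along a diagonal of the cube. *)

(** * Coordinates on three indices, the rotation action on tensors and the equivariance of d_2 *)

Notation o0 := (@Ordinal 3 0 isT).
Notation o1 := (@Ordinal 3 1 isT).
Notation o2 := (@Ordinal 3 2 isT).

Lemma sum3 (V : nmodType) (F : 'I_3 -> V) :
  \sum_(i < 3) F i = F o0 + F o1 + F o2.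
Proof.
rewrite !big_ord_recl big_ord0 addr0 addrA.
by congr (F _ + F _ + F _); apply: val_inj.
Qed.

Lemma forall3 (P : 'I_3 -> Prop) : P o0 -> P o1 -> P o2 -> forall i, P i.
Proof.
move=> P0 P1 P2 [[|[|[|n]]] // lti].
- by rewrite (_ : Ordinal lti = o0) //; apply: val_inj.
- by rewrite (_ : Ordinal lti = o1) //; apply: val_inj.
- by rewrite (_ : Ordinal lti = o2) //; apply: val_inj.
Qed.

Section Tensors.
Variable R : realType.
Implicit Types (g h : 'M[R]_3) (T : tensor4 R) (S : 'M[R]_3).

Lemma det3 g : \det g =
  g o0 o0 * (g o1 o1 * g o2 o2 - g o1 o2 * g o2 o1)
  - g o0 o1 * (g o1 o0 * g o2 o2 - g o1 o2 * g o2 o0)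
  + g o0 o2 * (g o1 o0 * g o2 o1 - g o1 o1 * g o2 o0).
Proof.
(* Entries are read through natural numbers so that the lifted indices of the cofactor expansion
   compute. *)
pose F (i j : nat) : R := g (inord i) (inord j).
have -> : g = \matrix_(i, j) F i j.
  by apply/matrixP => i j; rewrite mxE /F !inord_val.
rewrite (expand_det_row _ ord0) sum3 /cofactor.
rewrite !(expand_det_row _ ord0) !big_ord_recl !big_ord0 /cofactor !det_mx11 !mxE /=.
rewrite /bump /= !addn0 !add0n !addn1 /=; ring.
Qed.

Definition mx3 (a b c d e f x y z : R) : 'M[R]_3 :=
  \matrix_(i < 3, j < 3)
    nth 0 (nth [::] [:: [:: a; b; c]; [:: d; e; f]; [:: x; y; z]] i) j.

Lemma SO3M g h : SO3 g -> SO3 h -> SO3 (g *m h).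
Proof.
move=> [gg dg] [hh dh]; split; last by rewrite det_mulmx dg dh mulr1.
by rewrite trmx_mul mulmxA -(mulmxA g) hh mulmx1.
Qed.

Lemma SO3_tr g : SO3 g -> SO3 g^T.
Proof. by move=> [/mulmx1C gg dg]; split; rewrite ?trmxK ?det_tr. Qed.

Lemma SO3_1 : SO3 (1%:M : 'M[R]_3).
Proof. by split; rewrite ?det1 // trmx1 mulmx1. Qed.

(** Acting on one index at a time factors [act4] into four commuting maps, so that multiplicativity
    and orthogonality arguments involve one or two slots at a time. *)
Definition mode1 g T : tensor4 R := fun i j k l => \sum_a g i a * T a j k l.
Definition mode2 g T : tensor4 R := fun i j k l => \sum_b g j b * T i b k l.
Definition mode3 g T : tensor4 R := fun i j k l => \sum_c g k c * T i j c l.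
Definition mode4 g T : tensor4 R := fun i j k l => \sum_d g l d * T i j k d.

Lemma act4E g T : act4 g T = mode4 g (mode3 g (mode2 g (mode1 g T))).
Proof.
apply: funext => i; apply: funext => j; apply: funext => k; apply: funext => l.
by rewrite /act4 /mode1 /mode2 /mode3 /mode4 !sum3; ring.
Qed.

Lemma lin_mul g h (X : 'I_3 -> R) i :
  \sum_a (g *m h) i a * X a = \sum_a g i a * \sum_b h a b * X b.
Proof. by rewrite !sum3 !mxE !sum3; ring. Qed.

Lemma lin_swap g h (X : 'I_3 -> 'I_3 -> R) i j :
  \sum_a g i a * (\sum_b h j b * X a b) = \sum_b h j b * (\sum_a g i a * X a b).
Proof. by rewrite !sum3; ring. Qed.

Lemma act4M g h T : act4 (g *m h) T = act4 g (act4 h T).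
Proof.
have ext (A B : tensor4 R) : (forall i j k l, A i j k l = B i j k l) -> A = B.
  move=> AB; apply: funext => i; apply: funext => j.
  by apply: funext => k; apply: funext => l.
have c1 A : mode1 (g *m h) A = mode1 g (mode1 h A) by apply: ext => *; exact: lin_mul.
have c2 A : mode2 (g *m h) A = mode2 g (mode2 h A) by apply: ext => *; exact: lin_mul.
have c3 A : mode3 (g *m h) A = mode3 g (mode3 h A) by apply: ext => *; exact: lin_mul.
have c4 A : mode4 (g *m h) A = mode4 g (mode4 h A) by apply: ext => *; exact: lin_mul.
have s12 A : mode2 h (mode1 g A) = mode1 g (mode2 h A) by apply: ext => *; exact: lin_swap.
have s13 A : mode3 h (mode1 g A) = mode1 g (mode3 h A) by apply: ext => *; exact: lin_swap.
have s14 A : mode4 h (mode1 g A) = mode1 g (mode4 h A) by apply: ext => *; exact: lin_swap.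
have s23 A : mode3 h (mode2 g A) = mode2 g (mode3 h A) by apply: ext => *; exact: lin_swap.
have s24 A : mode4 h (mode2 g A) = mode2 g (mode4 h A) by apply: ext => *; exact: lin_swap.
have s34 A : mode4 h (mode3 g A) = mode3 g (mode4 h A) by apply: ext => *; exact: lin_swap.
by rewrite !act4E c1 c2 c3 c4 !(s12, s13, s14, s23, s24, s34).
Qed.

Lemma lin_1 (X : 'I_3 -> R) i : \sum_a (1%:M : 'M[R]_3) i a * X a = X i.
Proof.
rewrite (bigD1 i) //= mxE eqxx mul1r big1 ?addr0 // => a ai.
by rewrite mxE eq_sym (negbTE ai) mul0r.
Qed.

Lemma act4_1 T : act4 1%:M T = T.
Proof.
rewrite act4E; apply: funext => i; apply: funext => j.
apply: funext => k; apply: funext => l.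
by rewrite /mode4 lin_1 /mode3 lin_1 /mode2 lin_1 /mode1 lin_1.
Qed.

Lemma SO3_col g : SO3 g -> forall a b, \sum_i g i a * g i b = (a == b)%:R.
Proof.
move=> [/mulmx1C gg _] a b; have := congr1 (fun M : 'M_3 => M a b) gg.
by rewrite !mxE => <-; apply: eq_bigr => i _; rewrite mxE.
Qed.

Lemma SO3_row g : SO3 g -> forall a b, \sum_i g a i * g b i = (a == b)%:R.
Proof.
move=> [gg _] a b; have := congr1 (fun M : 'M_3 => M a b) gg.
by rewrite !mxE => <-; apply: eq_bigr => i _; rewrite mxE.
Qed.

Lemma SO3_dot g (X Y : 'I_3 -> R) : SO3 g ->
  \sum_n (\sum_a g n a * X a) * (\sum_b g n b * Y b) = \sum_a X a * Y a.
Proof.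
move=> /SO3_col gc.
transitivity (\sum_a \sum_b (\sum_n g n a * g n b) * (X a * Y b)).
  by rewrite !sum3; ring.
under eq_bigr do under eq_bigr do rewrite gc.
by rewrite !sum3 /=; ring.
Qed.

Lemma SO3_contract g (X : 'I_3 -> 'I_3 -> R) : SO3 g ->
  \sum_i \sum_a g i a * (\sum_b g i b * X a b) = \sum_a X a a.
Proof.
move=> /SO3_col gc.
transitivity (\sum_a \sum_b (\sum_n g n a * g n b) * X a b).
  by rewrite !sum3; ring.
under eq_bigr do under eq_bigr do rewrite gc.
by rewrite !sum3 /=; ring.
Qed.

Lemma act4_H4 g T : SO3 g -> H4 T -> H4 (act4 g T).
Proof.
move=> SOg [symT trT]; split.
  move=> i j k l; rewrite /act4; split; [|split].
  - rewrite exchange_big; do 4 (apply: eq_bigr => ? _).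
    by rewrite (proj1 (symT _ _ _ _)); ring.
  - apply: eq_bigr => ? _; rewrite exchange_big; do 3 (apply: eq_bigr => ? _).
    by rewrite (proj1 (proj2 (symT _ _ _ _))); ring.
  - do 2 (apply: eq_bigr => ? _); rewrite exchange_big; do 2 (apply: eq_bigr => ? _).
    by rewrite (proj2 (proj2 (symT _ _ _ _))); ring.
move=> k l.
transitivity (\sum_i \sum_a g i a * (\sum_b g i b *
   \sum_c \sum_d g k c * g l d * T a b c d)).
  by apply: eq_bigr => i _; rewrite /act4 !sum3; ring.
rewrite SO3_contract //.
transitivity (\sum_c \sum_d g k c * g l d * \sum_a T a a c d).
  by rewrite !sum3; ring.
by rewrite big1 // => c _; rewrite big1 // => d _; rewrite trT mulr0.
Qed.

(** Total symmetry aligns the three contracted indices and exhibits [d2 T] as a Gram matrix: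
    orthogonality then applies slot by slot, and the diagonal consists of sums of squares. *)
Lemma d2E T i j : totally_symmetric T ->
  d2 T i j = \sum_k \sum_m \sum_n T i k m n * T j k m n.
Proof.
move=> symT; rewrite /d2 /tr13 /ddot mxE.
apply: eq_bigr => k _; apply: eq_bigr => m _; apply: eq_bigr => n _.
have s1 a b c d : T a b c d = T b a c d by case: (symT a b c d).
have s2 a b c d : T a b c d = T a c b d by case: (symT a b c d) => _ [].
have s3 a b c d : T a b c d = T a b d c by case: (symT a b c d) => _ [].
by rewrite (s1 k) (s3 m n) (s2 m n) (s1 m) (s3 j m n) (s2 j m).
Qed.

Lemma d2_act4 g T : SO3 g -> H4 T -> d2 (act4 g T) = act2 g (d2 T).
Proof.
move=> SOg HT; have [symT _] := HT; have [symgT _] := act4_H4 SOg HT.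
apply/matrixP => i j; rewrite d2E // act4E.
set T1 := mode1 g T; set T2 := mode2 g T1; set T3 := mode3 g T2.
(* The contracted slots shed [g] one after another, the last one first, until [g] acts only on the
   free index. *)
transitivity (\sum_k \sum_m \sum_n T3 i k m n * T3 j k m n).
  by apply: eq_bigr => k _; apply: eq_bigr => m _; exact: SO3_dot.
transitivity (\sum_k \sum_m \sum_n T2 i k m n * T2 j k m n).
  apply: eq_bigr => k _; rewrite exchange_big [RHS]exchange_big.
  by apply: eq_bigr => n _; exact: SO3_dot.
transitivity (\sum_k \sum_m \sum_n T1 i k m n * T1 j k m n).
  rewrite exchange_big [RHS]exchange_big.
  apply: eq_bigr => m _; rewrite exchange_big [RHS]exchange_big.
  by apply: eq_bigr => n _; exact: SO3_dot.
rewrite /act2 !mxE !sum3 !mxE !sum3 !d2E // /T1 /mode1 !sum3; ring.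
Qed.

(* The harmonic part of the sum of the fourth powers of the columns of [g] (for [g] orthogonal). *)
Definition quart g : tensor4 R := fun i j k l =>
  \sum_m g i m * g j m * g k m * g l m
  - 5^-1 * ((g *m g^T) i j * (g *m g^T) k l + (g *m g^T) i k * (g *m g^T) j l
            + (g *m g^T) i l * (g *m g^T) j k).

(** Since [quart] keeps [g *m g^T] in place of the identity, this is a polynomial identity in the
    entries of [g]. *)
Lemma act4_quart1 g : act4 g (quart 1%:M) = quart g.
Proof.
apply: funext => i; apply: funext => j; apply: funext => k; apply: funext => l.
rewrite /act4 /quart !sum3 trmx1 mulmx1 !mxE /= !sum3 !mxE; ring.
Qed.

End Tensors.

(** * Symmetry groups: the cube group, its conjugates and the matrices it fixes *)

Section Symmetry.
Variable R : realType.
Implicit Types (g h : 'M[R]_3) (T : tensor4 R) (S : 'M[R]_3).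

Lemma quart_SO3 g : SO3 g -> quart g = fun i j k l =>
  \sum_m g i m * g j m * g k m * g l m
  - 5^-1 * ((i == j)%:R * (k == l)%:R + (i == k)%:R * (j == l)%:R
            + (i == l)%:R * (j == k)%:R).
Proof.
move=> [gg _]; rewrite /quart gg.
apply: funext => i; apply: funext => j; apply: funext => k; apply: funext => l.
by rewrite !mxE.
Qed.

(** Each column has at most one nonzero entry; the rotations of this kind are the signed permutation
    matrices of determinant 1. *)
Definition monomial_cols g := forall m i j, i != j -> g i m * g j m = 0.

(** Multiplying the orthogonality relation of columns [m] and [n] by its [i]-th term kills all the
    other terms and leaves the square of that one. *)
Lemma monomial_cols_tr g : SO3 g -> monomial_cols g -> monomial_cols g^T.
Proof.
move=> SOg mg i m n mn; rewrite !mxE; apply/eqP.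
have E := SO3_col SOg m n; rewrite (negbTE mn) in E.
move/(congr1 ( *%R (g i m * g i n))): E.
rewrite mulr0n mulr0 mulr_sumr (bigD1 i) //= big1 ?addr0; last first.
  move=> j ji; have := mg m _ _ ji.
  by rewrite mulrACA [g i m * _]mulrC => ->; rewrite mul0r.
by move/eqP; rewrite mulf_eq0 orbb.
Qed.

Lemma monomial_cols_1 : monomial_cols 1%:M.
Proof.
move=> m i j ij; rewrite !mxE; case: eqVneq => [im|]; last by rewrite mul0r.
by rewrite -im eq_sym (negbTE ij) mulr0.
Qed.

Lemma monomial_sum4 g : SO3 g -> monomial_cols g -> forall i j k l,
  \sum_m g i m * g j m * g k m * g l m = ((i == j) && (j == k) && (k == l))%:R.
Proof.
move=> SOg mg i j k l.
have [ij|ij] /= := eqVneq i j; last first.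
  by rewrite big1 // => m _; rewrite mg // !mul0r.
have [jk|jk] /= := eqVneq j k; last first.
  by rewrite big1 // => m _; rewrite -(mulrA (g i m)) (mg m j k) // mulr0 mul0r.
have [kl|kl] /= := eqVneq k l; last first.
  by rewrite big1 // => m _; rewrite -(mulrA _ (g k m)) (mg m k l) // mulr0.
(* Cross products within a row vanish, so its sum of fourth powers is the square of its sum of
   squares, which is 1. *)
rewrite ij jk kl; have mt := monomial_cols_tr SOg mg.
have E : \sum_m g l m * g l m = 1 by rewrite SO3_row ?eqxx.
rewrite -[RHS](expr1n _ 2) -[in RHS]E !sum3.
have E1 : g l o0 * g l o1 = 0 by have := mt l o0 o1 isT; rewrite !mxE.
have E2 : g l o0 * g l o2 = 0 by have := mt l o0 o2 isT; rewrite !mxE.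
have E3 : g l o1 * g l o2 = 0 by have := mt l o1 o2 isT; rewrite !mxE.
by ring: E1 E2 E3.
Qed.

Lemma symgroup4_quart1 : symgroup4 (quart 1%:M) = @cube_rotations R.
Proof.
apply/seteqP; split=> g [SOg]; rewrite /= => Hg; split => //.
  have mg : monomial_cols g.
    move=> m i j ij; move: Hg; rewrite act4_quart1 !quart_SO3 //; last exact: SO3_1.
    (* In the component [i i j j] the isotropic corrections cancel, and the squares of the products
       [g i m * g j m] sum to zero. *)
    move/(congr1 (fun T : tensor4 R => T i i j j)) => /addIr E.
    rewrite (monomial_sum4 (SO3_1 R) monomial_cols_1) (negbTE ij) andbF /= in E.
    apply/eqP; rewrite -sqrf_eq0; apply/eqP.
    have P (n : 'I_3) : true -> 0 <= g i n * g i n * g j n * g j n.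
      by move=> _; rewrite -mulrA -!expr2 mulr_ge0 ?sqr_ge0.
    by have := psumr_eq0P P E (i := m) isT => <- //; ring.
  have mt := monomial_cols_tr SOg mg.
  move=> v vv i; have v2 j : v j 0 ^+ 2 = 1.
    by case: (vv j) => ->; rewrite ?sqrrN expr1n.
  suff /eqP : (g *m v) i 0 ^+ 2 = 1.
    by rewrite sqrf_eq1 => /orP[]/eqP->; [left|right].
  have : \sum_m g i m * g i m = 1 by rewrite SO3_row ?eqxx.
  rewrite mxE !sum3 => E.
  have E1 : g i o0 * g i o1 = 0 by have := mt i o0 o1 isT; rewrite !mxE.
  have E2 : g i o0 * g i o2 = 0 by have := mt i o0 o2 isT; rewrite !mxE.
  have E3 : g i o1 * g i o2 = 0 by have := mt i o1 o2 isT; rewrite !mxE.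
  have := v2 o0; have := v2 o1; have := v2 o2 => V2 V1 V0.
  by rewrite -[RHS]E; ring: E1 E2 E3 V0 V1 V2.
have mt : monomial_cols g^T.
  have sq (a b c : R) i : (a = 1 \/ a = -1) -> (b = 1 \/ b = -1) -> (c = 1 \/ c = -1) ->
      (g i o0 * a + g i o1 * b + g i o2 * c) ^+ 2 = 1.
    move=> ha hb hc.
    have vv : is_vertex (\col_j nth 0 [:: a; b; c] j).
      by apply: forall3; rewrite mxE.
    have := Hg _ vv i; rewrite !mxE sum3 !mxE /=.
    by case=> ->; rewrite ?sqrrN expr1n.
  have p1 : (1 : R) = 1 \/ (1 : R) = -1 by left.
  have n1 : (-1 : R) = 1 \/ (-1 : R) = -1 by right.
  move=> i m n; rewrite !mxE.
  (* The vertex (1,1,1) and its three single sign changes suffice: equality of the four squares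
     makes the pairwise products of the row vanish. *)
  have A1 := sq 1 1 1 i p1 p1 p1; have A2 := sq (-1) 1 1 i n1 p1 p1.
  have A3 := sq 1 (-1) 1 i p1 n1 p1; have A4 := sq 1 1 (-1) i p1 p1 n1.
  have E1 : g i o0 * g i o1 = 0 by lra.
  have E2 : g i o0 * g i o2 = 0 by lra.
  have E3 : g i o1 * g i o2 = 0 by lra.
  by move: m n; apply: forall3; apply: forall3 => // _; rewrite 1?mulrC.
have mg : monomial_cols g by rewrite -[g]trmxK; apply: monomial_cols_tr (SO3_tr SOg) mt.
rewrite act4_quart1 !quart_SO3 //; last exact: SO3_1.
apply: funext => i; apply: funext => j; apply: funext => k; apply: funext => l.
by rewrite !monomial_sum4 //; [exact: SO3_1 | exact: monomial_cols_1].
Qed.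

Lemma symgroup4_act4 g T : SO3 g ->
  symgroup4 (act4 g T) = [set g *m k *m g^T | k in symgroup4 T].
Proof.
move=> SOg; have [gg _] := SOg; have g'g := mulmx1C gg.
apply/seteqP; split => [h [SOh hT]|_ [k [SOk kT] <-]].
  exists (g^T *m h *m g); last first.
    by rewrite !mulmxA gg mul1mx -mulmxA gg mulmx1.
  split; first by do !apply: SO3M => //; exact: SO3_tr.
  by rewrite !act4M hT -act4M g'g act4_1.
split; first by do !apply: SO3M => //; exact: SO3_tr.
by rewrite -act4M -mulmxA g'g mulmx1 act4M kT.
Qed.

Definition scale4 (c : R) T : tensor4 R := fun i j k l => c * T i j k l.

Lemma act4_scale4 g c T : act4 g (scale4 c T) = scale4 c (act4 g T).
Proof.
apply: funext => i; apply: funext => j; apply: funext => k; apply: funext => l.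
rewrite /act4 /scale4; do 4 (rewrite mulr_sumr; apply: eq_bigr => ? _).
by rewrite mulrCA.
Qed.

Lemma symgroup4_scale4 c T : c != 0 -> symgroup4 (scale4 c T) = symgroup4 T.
Proof.
move=> c0; apply/seteqP; split => g [SOg gT]; split=> //; last first.
  by rewrite act4_scale4 gT.
have K A : scale4 c^-1 (scale4 c A) = A.
  apply: funext => i; apply: funext => j; apply: funext => k; apply: funext => l.
  by rewrite /scale4 mulKf.
by rewrite -[LHS]K -act4_scale4 gT K.
Qed.

(** Conjugation by a rotation maps SO(3) onto itself, so this class has a single member. *)
Lemma isotropicP (G : set 'M[R]_3) : isotropic G <-> G = @SO3 R.
Proof.
split=> [[g SOg ->]|->]; last first.
  exists 1%:M; first exact: SO3_1.
  apply/seteqP; split => [k SOk|_ [k SOk <-]]; last by rewrite mul1mx trmx1 mulmx1.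
  by exists k => //; rewrite mul1mx trmx1 mulmx1.
have [gg _] := SOg.
apply/seteqP; split => [_ [k SOk <-]|h SOh].
  by do !apply: SO3M => //; exact: SO3_tr.
exists (g^T *m h *m g); first by do !apply: SO3M => //; exact: SO3_tr.
by rewrite !mulmxA gg mul1mx -mulmxA gg mulmx1.
Qed.

Lemma mx3_cube_rotations :
  [/\ cube_rotations (mx3 1 0 0 0 (-1) 0 0 0 (-1) : 'M[R]_3),
      cube_rotations (mx3 (-1) 0 0 0 (-1) 0 0 0 1 : 'M[R]_3) &
      cube_rotations (mx3 0 1 0 0 0 1 1 0 0 : 'M[R]_3)].
Proof.
have opp (x : R) : x = 1 \/ x = -1 -> - x = 1 \/ - x = -1.
  by case=> ->; [right | left; rewrite opprK].
split; (split; first split;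
  [by apply/matrixP; apply: forall3; apply: forall3;
     rewrite !mxE sum3 !mxE /=; ring
  |by rewrite det3 !mxE /=; ring
  |move=> v vv; apply: forall3; rewrite !mxE sum3 !mxE /= ?mulN1r ?mul1r
     ?mul0r ?addr0 ?add0r; by [exact: vv | apply: opp; exact: vv]]).
Qed.

(** The half-turns about two axes kill the off-diagonal entries, and the cyclic permutation of the
    axes equates the diagonal ones. *)
Lemma cube_rotations_fixed S :
  (forall g, cube_rotations g -> act2 g S = S) -> exists c, S = c%:M.
Proof.
move=> fS; have [/fS A /fS B /fS C] := mx3_cube_rotations.
exists (S o0 o0); apply/matrixP.
have a i j := congr1 (fun M : 'M[R]_3 => M i j) A.
have b i j := congr1 (fun M : 'M[R]_3 => M i j) B.
have c i j := congr1 (fun M : 'M[R]_3 => M i j) C.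
have {A}a01 := a o0 o1; have a02 := a o0 o2; have a10 := a o1 o0; have {a}a20 := a o2 o0.
have {B}b12 := b o1 o2; have {b}b21 := b o2 o1.
have {C}c00 := c o0 o0; have {c}c11 := c o1 o1.
move: a01 a02 a10 a20 b12 b21 c00 c11.
rewrite /act2 !mxE !sum3 !mxE !sum3 !mxE /= => a01 a02 a10 a20 b12 b21 c00 c11.
by apply: forall3; apply: forall3; rewrite mxE /= ?mulr1n ?mulr0n; lra.
Qed.

Lemma SO3_act2_scalar g c : SO3 g -> act2 g c%:M = c%:M.
Proof. by move=> [gg _]; rewrite /act2 mul_mx_scalar -scalemxAl gg scalemx1. Qed.

Lemma isotropic_symgroup2_scalar S : isotropic (symgroup2 S) -> exists c, S = c%:M.
Proof.
move/isotropicP => E; apply: cube_rotations_fixed => g [SOg _].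
by move: SOg; rewrite -E => -[_]; apply.
Qed.

Lemma polyfun_sum (F : 'I_3 -> tensor4 R -> R) :
  (forall i, polyfun (F i)) -> polyfun (fun T => \sum_i F i T).
Proof.
move=> pF; rewrite (_ : (fun T => _) = fun T => F o0 T + F o1 T + F o2 T).
  by do !apply: pf_add.
by apply: funext => T; rewrite sum3.
Qed.

Lemma d2_equivariant : equivariant_poly_map (@d2 R).
Proof.
split=> [i j|T [symT _]|g T]; last exact: d2_act4; last first.
  apply/matrixP => i j; rewrite mxE !d2E //.
  by do 3 (apply: eq_bigr => ? _); rewrite mulrC.
rewrite (_ : (fun T => _) =
  fun T => \sum_k \sum_m \sum_n T k i m n * T m n k j).
  by do 3 (apply: polyfun_sum => ?); apply: pf_mul; apply: pf_coord.
by apply: funext => T; rewrite /d2 /tr13 mxE.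
Qed.

(* Covers both alternatives of (2), as [cube_rotations] is part of [SO3]. *)
Lemma Cov2_isotropic (H : tensor4 R) (f : 'M[R]_3) : H4 H -> SO3 f ->
  (forall k, cube_rotations k -> symgroup4 H (f *m k *m f^T)) ->
  isotropic (symgroup2_family (Cov2 H)).
Proof.
move=> hH SOf cH; have [ff _] := SOf; have f'f := mulmx1C ff.
apply/isotropicP/seteqP; split=> [g []//|g SOg]; split=> // _ [F [[_ _ eqF] ->]].
suff [c ->] : exists c, F H = c%:M by exact: SO3_act2_scalar.
(* By equivariance [F H] is fixed by every [f *m k *m f^T]; pulled back by [f], it is fixed by the
   cube group in standard position. *)
have [|c Ec] := @cube_rotations_fixed (f^T *m F H *m f).
  move=> k /cH [SOk kH]; move: (eqF _ _ SOk hH); rewrite kH {1}/act2 => E.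
  rewrite {2}E /act2 !trmx_mul trmxK !mulmxA f'f mul1mx.
  by rewrite -(mulmxA _ f^T f) f'f mulmx1.
exists c; have := congr1 (fun M => f *m M *m f^T) Ec.
rewrite !mulmxA ff mul1mx -mulmxA ff mulmx1 => ->.
exact: SO3_act2_scalar.
Qed.

End Symmetry.

(** * Zeros of a quartic form on the conic of null vectors *)

Lemma coef_mul_top (F : nzRingType) (p q : {poly F}) (m n : nat) :
  (size p <= m.+1)%N -> (size q <= n.+1)%N -> (p * q)`_(m + n) = p`_m * q`_n.
Proof.
move=> sp sq; rewrite coefM.
have lm : (m < (m + n).+1)%N by rewrite ltnS leq_addr.
rewrite (bigD1 (Ordinal lm)) //= big1 ?addr0 ?addKn // => i.
rewrite -val_eqE /= neq_ltn => /orP[im|im]; last first.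
  by rewrite (nth_default _ (leq_trans sp im)) mul0r.
rewrite [q`__]nth_default ?mulr0 // (leq_trans sq) //.
by rewrite ltn_subRL ltn_add2r.
Qed.

Lemma size_mul_top (F : nzRingType) (p q : {poly F}) (m n : nat) :
  (size p <= m.+1)%N -> (size q <= n.+1)%N -> (size (p * q)%R <= (m + n).+1)%N.
Proof.
move=> sp sq; apply: leq_trans (size_polyMleq _ _) _.
by rewrite -subn1 leq_subLR (leq_trans (leq_add sp sq)) // addSn addnS add1n.
Qed.

Definition quartic (F : comNzRingType) (A : 'I_3 -> 'I_3 -> 'I_3 -> 'I_3 -> F)
    (x : 'I_3 -> F) : F :=
  \sum_i \sum_j \sum_k \sum_l A i j k l * (x i * x j * (x k * x l)).

(* The second alternative is a zero at w = infinity. *)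
Lemma quartic_zero_on_conic (F : closedFieldType)
    (A : 'I_3 -> 'I_3 -> 'I_3 -> 'I_3 -> F) (Z : 'I_3 -> {poly F}) :
  (forall i, (size (Z i) <= 3)%N) ->
  (exists w, quartic A (fun i => (Z i).[w]) = 0) \/ quartic A (fun i => (Z i)`_2) = 0.
Proof.
move=> sZ.
pose P := \sum_i \sum_j \sum_k \sum_l (A i j k l)%:P * (Z i * Z j * (Z k * Z l)).
have sZ2 i j : (size (Z i * Z j)%R <= 5)%N by exact: (size_mul_top (m := 2) (n := 2)).
(* Only a nonzero constant [P] has no root. Its coefficient of degree 8 is then zero, and this is
   the quartic at the coefficients of degree 2. Some [Z i] may have lower degree, so these need not
   be leading coefficients. *)
have [s1|] := eqVneq (size P) 1.
  right; transitivity P`_8; last by rewrite nth_default // s1.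
  rewrite /P /quartic; do 4 (rewrite coef_sum; apply: eq_bigr => ? _).
  rewrite coefCM (coef_mul_top (m := 4) (n := 4)) //.
  by rewrite !(coef_mul_top (m := 2) (n := 2)).
move=> /closed_rootP[w /rootP Pw]; left; exists w; rewrite -Pw /P /quartic.
do 4 (rewrite horner_sum; apply: eq_bigr => ? _).
by rewrite !hornerM hornerC.
Qed.

Section NullDirection.
Variable R : realType.
Implicit Types (T : tensor4 R) (u v : 'I_3 -> R).

(** [R[i]] is algebraically closed, so X + iY has a cube root c + is; its squared modulus is
    nonnegative with cube 1, hence equals 1. *)
Lemma unit_cube_root (X Y : R) : X ^+ 2 + Y ^+ 2 = 1 ->
  exists c s, [/\ c ^+ 2 + s ^+ 2 = 1, c ^+ 3 - 3 * c * s ^+ 2 = X &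
                 3 * c ^+ 2 * s - s ^+ 3 = Y].
Proof.
move=> XY; pose P (n : nat) : R[i] := if n is 0 then Complex X Y else 0.
have [[c s]] := solve_monicpoly P (isT : 0 < 3)%N.
rewrite sum3 /P /= expr0 mulr1 !mul0r !addr0 !exprS expr0 mulr1.
case=> EX EY.
exists c, s; have E1 : c ^+ 3 - 3 * c * s ^+ 2 = X by rewrite -EX; ring.
have E2 : 3 * c ^+ 2 * s - s ^+ 3 = Y by rewrite -EY; ring.
split=> //; apply/eqP.
rewrite -(@pexpr_eq1 _ _ 3) ?addr_ge0 ?sqr_ge0 //; apply/eqP.
by rewrite -[RHS]XY -E1 -E2; ring.
Qed.

(** Real part of T(z,z,z,z) for z = u + iv, with the placements of [u] and [v] listed separately
    because [T] need not be symmetric here. *)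
Definition quartic_Re T u v := \sum_i \sum_j \sum_k \sum_l T i j k l *
  (u i * u j * u k * u l + v i * v j * v k * v l
   - (u i * u j * v k * v l + u i * v j * u k * v l + u i * v j * v k * u l
     + v i * u j * u k * v l + v i * u j * v k * u l + v i * v j * u k * u l)).

Definition quartic_Im T u v := \sum_i \sum_j \sum_k \sum_l T i j k l *
  (u i * u j * u k * v l + u i * u j * v k * u l + u i * v j * u k * u l + v i * u j * u k * u l
   - (u i * v j * v k * v l + v i * u j * v k * v l + v i * v j * u k * v l
      + v i * v j * v k * u l)).

Lemma quartic_complex T u v :
  quartic (fun i j k l => Complex (T i j k l) 0) (fun i => Complex (u i) (v i)) =
  Complex (quartic_Re T u v) (quartic_Im T u v).
Proof.
have cs (G : 'I_3 -> R[i]) (a b : 'I_3 -> R) : (forall i, G i = Complex (a i) (b i)) ->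
    \sum_i G i = Complex (\sum_i a i) (\sum_i b i).
  by move=> Gab; rewrite !sum3 !Gab.
apply: (cs) => i; apply: (cs) => j; apply: (cs) => k; apply: (cs) => l.
by apply/eqP; rewrite eq_complex /=; apply/andP; split; apply/eqP; ring.
Qed.

(** The null conic is parametrised by w -> (1 - w^2, i(1 + w^2), 2w), and the quartic has a zero on
    it. Since z.z = 0, the real and imaginary parts of z are orthogonal and of equal length. *)
Lemma null_frame T : exists u v,
  [/\ \sum_i u i * u i = 1, \sum_i v i * v i = 1, \sum_i u i * v i = 0,
      quartic_Re T u v = 0 & quartic_Im T u v = 0].
Proof.
(* All conditions are homogeneous, so the frame may be found up to a common length [r]. *)
suff [r [u [v [r0 [uu vv uv Q]]]]] : exists r u v, r != 0 /\
    [/\ \sum_i u i * u i = r ^+ 2, \sum_i v i * v i = r ^+ 2, \sum_i u i * v i = 0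
      & quartic (fun i j k l => Complex (T i j k l) 0)
                (fun i => Complex (u i) (v i)) = 0].
  move: Q; rewrite quartic_complex => -[QR QI].
  exists (fun i => r^-1 * u i), (fun i => r^-1 * v i).
  have K (a b : 'I_3 -> R) : \sum_i (r^-1 * a i) * (r^-1 * b i) = r ^- 2 * \sum_i a i * b i.
    by rewrite !sum3 -exprVn; ring.
  rewrite !K uu vv uv mulr0 mulVf ?expf_neq0 //; split=> //.
    rewrite -[RHS](mulr0 (r^-1 ^+ 4)) -[X in _ = _ * X]QR /quartic_Re.
    by do 4 (rewrite mulr_sumr; apply: eq_bigr => ? _); ring.
  rewrite -[RHS](mulr0 (r^-1 ^+ 4)) -[X in _ = _ * X]QI /quartic_Im.
  by do 4 (rewrite mulr_sumr; apply: eq_bigr => ? _); ring.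
pose I : R[i] := Complex 0 1.
pose Z (i : 'I_3) : {poly R[i]} :=
  Poly (nth [::] [:: [:: 1; 0; -1]; [:: I; 0; I]; [:: 0; 2; 0]] i).
have sZ i : (size (Z i) <= 3)%N.
  by apply: leq_trans (size_Poly _) _; move: i; apply: forall3.
have [[[a b] Q]|Q] := quartic_zero_on_conic (fun i j k l => Complex (T i j k l) 0) sZ.
  (* For w = a + ib, the real and imaginary parts of the point of the conic both have length 1 +
     |w|^2. *)
  exists (1 + a ^+ 2 + b ^+ 2).
  exists (fun i => nth 0 [:: 1 - a ^+ 2 + b ^+ 2; - (2 * a * b); 2 * a] i).
  exists (fun i => nth 0 [:: - (2 * a * b); 1 + a ^+ 2 - b ^+ 2; 2 * b] i).
  split; first by apply: lt0r_neq0; rewrite -addrA ltr_wpDr // addr_ge0 // sqr_ge0.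
  rewrite !sum3 /=; split; try ring.
  rewrite -[RHS]Q; congr quartic; apply: funext; apply: forall3;
  rewrite /Z horner_Poly /=; apply/eqP; rewrite eq_complex /=;
    apply/andP; split; apply/eqP; ring.
(* The point at infinity of the conic is (-1, i, 0). *)
exists 1, (fun i => nth 0 [:: -1; 0; 0] i), (fun i => nth 0 [:: 0; 1; 0] i).
split; first exact: oner_neq0.
rewrite !sum3 /=; split; try ring.
rewrite -[RHS]Q; congr quartic; apply: funext; apply: forall3;
by rewrite /Z coef_Poly /=; apply/eqP; rewrite eq_complex /=;
    apply/andP; split; apply/eqP; ring.
Qed.

Lemma SO3_frame u v :
  \sum_i u i * u i = 1 -> \sum_i v i * v i = 1 -> \sum_i u i * v i = 0 ->
  SO3 (mx3 (u o0) (u o1) (u o2) (v o0) (v o1) (v o2)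
    (u o1 * v o2 - u o2 * v o1) (u o2 * v o0 - u o0 * v o2) (u o0 * v o1 - u o1 * v o0)).
Proof.
rewrite !sum3 => uu vv uv.
have E : (u o1 * v o2 - u o2 * v o1) ^+ 2 + (u o2 * v o0 - u o0 * v o2) ^+ 2 +
   (u o0 * v o1 - u o1 * v o0) ^+ 2 = 1.
  (* Lagrange's identity for the length of the cross product. *)
  transitivity ((u o0 * u o0 + u o1 * u o1 + u o2 * u o2)
    * (v o0 * v o0 + v o1 * v o1 + v o2 * v o2)
    - (u o0 * v o0 + u o1 * v o1 + u o2 * v o2) ^+ 2); first by ring.
  by rewrite uu vv uv; ring.
split; last by rewrite det3 !mxE /= -[RHS]E; ring.
apply/matrixP; apply: forall3; apply: forall3; rewrite !mxE sum3 !mxE /= ?mulr1n ?mulr0n //;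
by [ring | rewrite -[RHS]uv; ring | rewrite -[RHS]E; ring].
Qed.

(** With the null frame as the first two rows of [g], the two equations are the real and imaginary
    parts of the rotated tensor evaluated four times at e_1 + i e_2. *)
Lemma null_axis T : H4 T -> exists2 g, SO3 g &
  act4 g T o0 o0 o0 o0 - 6 * act4 g T o0 o0 o1 o1 + act4 g T o1 o1 o1 o1 = 0 /\
  act4 g T o0 o0 o0 o1 = act4 g T o0 o1 o1 o1.
Proof.
move=> hT; have [u [v [uu vv uv QR QI]]] := null_frame T.
have SOg := SO3_frame uu vv uv; set g := mx3 _ _ _ _ _ _ _ _ _ in SOg.
exists g => //; have [sg _] := act4_H4 SOg hT.
have gu a : g o0 a = u a by move: a; apply: forall3; rewrite mxE.
have gv a : g o1 a = v a by move: a; apply: forall3; rewrite mxE.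
have s1 a b c d : act4 g T a b c d = act4 g T b a c d by case: (sg a b c d).
have s2 a b c d : act4 g T a b c d = act4 g T a c b d by case: (sg a b c d) => _ [].
have s3 a b c d : act4 g T a b c d = act4 g T a b d c by case: (sg a b c d) => _ [].
have sum4D (A B : tensor4 R) : \sum_i \sum_j \sum_k \sum_l A i j k l +
   \sum_i \sum_j \sum_k \sum_l B i j k l = \sum_i \sum_j \sum_k \sum_l (A i j k l + B i j k l).
  by do 4 (rewrite -big_split; apply: eq_bigr => ? _).
have sum4N (A : tensor4 R) : - (\sum_i \sum_j \sum_k \sum_l A i j k l) =
   \sum_i \sum_j \sum_k \sum_l (- A i j k l).
  by do 4 (rewrite -sumrN; apply: eq_bigr => ? _).
split.
  rewrite -[RHS]QR.
  (* Symmetry is used backwards: the multiple of 6 is split into the six placements of the indices,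
     which then match [quartic_Re] term by term. *)
  transitivity (act4 g T o0 o0 o0 o0 + act4 g T o1 o1 o1 o1 -
   (act4 g T o0 o0 o1 o1 + act4 g T o0 o1 o0 o1 + act4 g T o0 o1 o1 o0 +
    act4 g T o1 o0 o0 o1 + act4 g T o1 o0 o1 o0 + act4 g T o1 o1 o0 o0)).
    rewrite !(s1 o1 o0) !(s2 _ o1 o0) !(s3 _ _ o1 o0) !(s1 o1 o0) !(s2 _ o1 o0); ring.
  rewrite /act4 !(sum4D, sum4N).
  by do 4 (apply: eq_bigr => ? _); rewrite !gu !gv; ring.
have : 4 * (act4 g T o0 o0 o0 o1 - act4 g T o0 o1 o1 o1) = 0; last by lra.
rewrite -[RHS]QI.
transitivity (act4 g T o0 o0 o0 o1 + act4 g T o0 o0 o1 o0 + act4 g T o0 o1 o0 o0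
   + act4 g T o1 o0 o0 o0 -
   (act4 g T o0 o1 o1 o1 + act4 g T o1 o0 o1 o1 + act4 g T o1 o1 o0 o1
   + act4 g T o1 o1 o1 o0)).
  by rewrite !(s1 o1 o0) !(s2 _ o1 o0) !(s3 _ _ o1 o0) !(s2 _ o1 o0) !(s1 o1 o0) ; ring.
rewrite /act4 !(sum4D, sum4N).
by do 4 (apply: eq_bigr => ? _); rewrite !gu !gv; ring.
Qed.

End NullDirection.

(** * The equations between weight components, and coordinates on harmonic tensors *)

Section NormalForm.
Variable R : realType.
Implicit Types (T : tensor4 R).

(** The letters stand for |p|^2, |q|^2, |r|^2, t^2. Eliminating ABD from the two inequalities bounds
    48 A^2 C by a multiple of C D^2; as D <= 32/25 A, that multiple is at most 19 A^2 C. Hence C = 0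
    if A > 0, and then B = 0. *)
Lemma moduli_vanish (A B C D : R) : 0 <= A -> 0 <= B -> 0 <= C -> 0 <= D ->
  A = B + 17 / 16 * C + 25 / 32 * D ->
  48 * (A * C) <= 225 * (B * D) -> 77 / 10 * (A * B) <= 25 / 64 * (C * D) ->
  B = 0 /\ C = 0.
Proof.
move=> A0 B0 C0 D0 EA H1 H2.
have [A00|An0] := eqVneq A 0; first by split; lra.
have Ap : 0 < A by rewrite lt_def An0.
have H3 : A * (48 * (A * C)) <= A * (225 * (B * D)) by rewrite ler_pM2l.
have H4 : D * (77 / 10 * (A * B)) <= D * (25 / 64 * (C * D)) by rewrite ler_wpM2l.
have H5 : D * D <= 32 / 25 * (A * D) by rewrite mulrA ler_wpM2r //; lra.
have H6 : 25 / 32 * (A * D) <= A * A by rewrite mulrCA ler_pM2l //; lra.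
have H7 : C * (D * D) <= C * (1024 / 625 * (A * A)) by rewrite ler_wpM2l //; lra.
have C00 : C = 0.
  have : C * (A * A) <= 0 by lra.
  rewrite pmulr_lle0 ?mulr_gt0 // => C1; apply/eqP; rewrite eq_le C1 C0 //.
split=> //; have : A * B <= 0 by move: H2; rewrite C00 !mul0r mulr0; lra.
by rewrite pmulr_rle0 // => B1; apply/eqP; rewrite eq_le B1 B0.
Qed.

(* The hypotheses are the three equations of the header, with p = p1 + i p2 etc. *)
Lemma weights_vanish (p1 p2 q1 q2 r1 r2 t : R) :
  12 * (p1 * r1 + p2 * r2) + 15 * (q1 * t) - 5 * (r1 ^+ 2 - r2 ^+ 2) = 0 ->
  12 * (p2 * r1 - p1 * r2) + 15 * (q2 * t) - 5 * (2 * r1 * r2) = 0 ->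
  5 * (p1 * q1 + p2 * q2) + 9 / 4 * (q1 * r1 + q2 * r2) + 5 / 8 * (r1 * t) = 0 ->
  5 * (p2 * q1 - p1 * q2) + 9 / 4 * (q2 * r1 - q1 * r2) + 5 / 8 * (r2 * t) = 0 ->
  p1 ^+ 2 + p2 ^+ 2 = q1 ^+ 2 + q2 ^+ 2 + 17 / 16 * (r1 ^+ 2 + r2 ^+ 2)
    + 25 / 32 * t ^+ 2 ->
  [/\ q1 = 0, q2 = 0, r1 = 0 & r2 = 0].
Proof.
move=> E1 E2 E3 E4 E5.
set A := p1 ^+ 2 + p2 ^+ 2 in E5; set B := q1 ^+ 2 + q2 ^+ 2 in E5.
set C := r1 ^+ 2 + r2 ^+ 2 in E5; set D := t ^+ 2 in E5.
have sq2 (x y : R) : 0 <= x ^+ 2 + y ^+ 2 by rewrite addr_ge0 ?sqr_ge0.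
have A0 : 0 <= A by exact: sq2.
have B0 : 0 <= B by exact: sq2.
have C0 : 0 <= C by exact: sq2.
have D0 : 0 <= D by exact: sqr_ge0.
have CA : C <= 16 / 17 * A by lra.
(* Take x = 6 p conj(r) and y = 5 r^2 in |2x - y|^2 = 2|x - y|^2 + 2|x|^2 - |y|^2; by C <= 16/17 A,
   the last two terms are at least 48 AC. *)
have H1 : 48 * (A * C) <= 225 * (B * D).
  have F1 : 225 * (B * D) = (12 * (p1 * r1 + p2 * r2) - 5 * (r1 ^+ 2 - r2 ^+ 2)) ^+ 2 +
     (12 * (p2 * r1 - p1 * r2) - 5 * (2 * r1 * r2)) ^+ 2.
    transitivity ((15 * (q1 * t)) ^+ 2 + (15 * (q2 * t)) ^+ 2); first by rewrite /B /D; ring.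
    by congr (_ + _); rewrite -[LHS]sqrrN; congr (_ ^+ 2); lra.
  have F2 : 0 <= (6 * (p1 * r1 + p2 * r2) - 5 * (r1 ^+ 2 - r2 ^+ 2)) ^+ 2 +
     (6 * (p2 * r1 - p1 * r2) - 5 * (2 * r1 * r2)) ^+ 2 by exact: sq2.
  have F3 : 225 * (B * D) = 2 * ((6 * (p1 * r1 + p2 * r2) - 5 * (r1 ^+ 2 - r2 ^+ 2)) ^+ 2 +
     (6 * (p2 * r1 - p1 * r2) - 5 * (2 * r1 * r2)) ^+ 2) + 72 * (A * C) - 25 * (C * C).
    by rewrite F1 /A /C; ring.
  have F4 : C * C <= 16 / 17 * A * C by rewrite ler_wpM2r.
  have F5 : 0 <= A * C by rewrite mulr_ge0.
  by lra.
(* The same identity for |2x + y|^2, with x = 5/2 p conj(q) and y = 9/4 q conj(r). *)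
have H2 : 77 / 10 * (A * B) <= 25 / 64 * (C * D).
  have F1 : 25 / 64 * (C * D) = (5 * (p1 * q1 + p2 * q2) + 9 / 4 * (q1 * r1 + q2 * r2)) ^+ 2 +
     (5 * (p2 * q1 - p1 * q2) + 9 / 4 * (q2 * r1 - q1 * r2)) ^+ 2.
    transitivity ((5 / 8 * (r1 * t)) ^+ 2 + (5 / 8 * (r2 * t)) ^+ 2); first by rewrite /C /D; field.
    by congr (_ + _); rewrite -[LHS]sqrrN; congr (_ ^+ 2); lra.
  have F2 : 0 <= (5 / 2 * (p1 * q1 + p2 * q2) + 9 / 4 * (q1 * r1 + q2 * r2)) ^+ 2 +
     (5 / 2 * (p2 * q1 - p1 * q2) + 9 / 4 * (q2 * r1 - q1 * r2)) ^+ 2 by exact: sq2.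
  have F3 : 25 / 64 * (C * D) =
     2 * ((5 / 2 * (p1 * q1 + p2 * q2) + 9 / 4 * (q1 * r1 + q2 * r2)) ^+ 2 +
     (5 / 2 * (p2 * q1 - p1 * q2) + 9 / 4 * (q2 * r1 - q1 * r2)) ^+ 2)
      + 25 / 2 * (A * B) - 81 / 16 * (C * B).
    by rewrite F1 /A /C /B; field.
  have F4 : C * B <= 16 / 17 * A * B by rewrite ler_wpM2r.
  have F5 : 0 <= A * B by rewrite mulr_ge0.
  by lra.
have [/eqP B00 /eqP C00] := moduli_vanish A0 B0 C0 D0 E5 H1 H2.
move: B00 C00; rewrite /B /C !paddr_eq0 ?sqr_ge0 // !sqrf_eq0.
by move=> /andP[/eqP -> /eqP ->] /andP[/eqP -> /eqP ->].
Qed.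

(** Each rule swaps one specific adjacent inversion of concrete indices, so repeated rewriting stops
    at the component with sorted indices. *)
Definition sort_rules T (sT : totally_symmetric T) :=
  let s1 a b c d : T a b c d = T b a c d := proj1 (sT a b c d) in
  let s2 a b c d : T a b c d = T a c b d := proj1 (proj2 (sT a b c d)) in
  let s3 a b c d : T a b c d = T a b d c := proj2 (proj2 (sT a b c d)) in
  (s1 o1 o0, s1 o2 o0, s1 o2 o1,
   fun a => s2 a o1 o0, fun a => s2 a o2 o0, fun a => s2 a o2 o1,
   fun a b => s3 a b o1 o0, fun a b => s3 a b o2 o0, fun a b => s3 a b o2 o1).

(** The six traces eliminate six of the fifteen sorted components; the nine that remain are
    coordinates on the harmonic tensors. *)
Lemma H4_trace T : H4 T ->
  [/\ T o0 o0 o1 o1 = - T o0 o0 o0 o0 - T o0 o0 o2 o2,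
      T o1 o1 o2 o2 = - T o0 o0 o2 o2 - T o2 o2 o2 o2,
      T o1 o1 o1 o1 = T o0 o0 o0 o0 + 2 * T o0 o0 o2 o2 + T o2 o2 o2 o2 &
   [/\ T o0 o1 o1 o1 = - T o0 o0 o0 o1 - T o0 o1 o2 o2,
      T o0 o1 o1 o2 = - T o0 o0 o0 o2 - T o0 o2 o2 o2 &
      T o1 o1 o1 o2 = - T o0 o0 o1 o2 - T o1 o2 o2 o2]].
Proof.
move=> [sT tT].
have := tT o0 o0; have := tT o1 o1; have := tT o2 o2.
have := tT o0 o1; have := tT o0 o2; have := tT o1 o2.
rewrite !sum3 !(sort_rules sT) => e1 e2 e3 e4 e5 e6.
by do ?split; lra.
Qed.

Lemma H4_ext T T' : H4 T -> H4 T' ->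
  [/\ T o0 o0 o0 o0 = T' o0 o0 o0 o0, T o0 o0 o0 o1 = T' o0 o0 o0 o1,
      T o0 o0 o0 o2 = T' o0 o0 o0 o2, T o0 o0 o1 o2 = T' o0 o0 o1 o2 &
  [/\ T o0 o0 o2 o2 = T' o0 o0 o2 o2, T o0 o1 o2 o2 = T' o0 o1 o2 o2,
      T o0 o2 o2 o2 = T' o0 o2 o2 o2, T o1 o2 o2 o2 = T' o1 o2 o2 o2 &
      T o2 o2 o2 o2 = T' o2 o2 o2 o2]] -> T = T'.
Proof.
move=> hT hT' [e1 e2 e3 e4 [e5 e6 e7 e8 e9]].
have [a1 a2 a3 [a4 a5 a6]] := H4_trace hT; have [b1 b2 b3 [b4 b5 b6]] := H4_trace hT'.
have [sT _] := hT; have [sT' _] := hT'.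
apply: funext; apply: forall3; apply: funext; apply: forall3;
apply: funext; apply: forall3; apply: funext; apply: forall3;
by rewrite ?(sort_rules sT) ?(sort_rules sT') //
     ?(a1, a2, a3, a4, a5, a6) ?(b1, b2, b3, b4, b5, b6)
     ?(e1, e2, e3, e4, e5, e6, e7, e8, e9).
Qed.

End NormalForm.

(** * Tensors with scalar d_2 are multiples of a rotated cubic tensor *)

Section CubicForm.
Variable R : realType.
Implicit Types (T : tensor4 R) (g : 'M[R]_3).

Lemma H4_quart g : SO3 g -> H4 (quart g).
Proof.
move=> SOg; rewrite -act4_quart1; apply: act4_H4 => //.
rewrite quart_SO3; last exact: SO3_1.
split.
  move=> i j k l; rewrite !sum3 ![i == _]eq_sym ![j == _]eq_sym ![k == _]eq_sym.
  rewrite ?[i == _]eq_sym ?[j == _]eq_sym ?[k == _]eq_sym.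
  by split; [|split]; ring.
by apply: forall3; apply: forall3; rewrite !sum3 !mxE /=; field.
Qed.

Lemma H4_scale4 c T : H4 T -> H4 (scale4 c T).
Proof.
move=> [sT tT]; split=> [i j k l|k l]; last by rewrite -mulr_sumr tT mulr0.
by rewrite /scale4; have [-> [-> ->]] := sT i j k l.
Qed.

(* The columns are an orthonormal frame permuted by the rotation of order 3 about the last axis. *)
Lemma SO3_threefold (a e c s : R) :
  a ^+ 2 = 6 -> e ^+ 2 = 3 -> s ^+ 2 = 1 - c ^+ 2 ->
  SO3 (mx3 (a / 3 * c) (a / 3 * (- c / 2 - e / 2 * s)) (a / 3 * (- c / 2 + e / 2 * s))
           (a / 3 * s) (a / 3 * (e / 2 * c - s / 2)) (a / 3 * (- e / 2 * c - s / 2))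
           (e / 3) (e / 3) (e / 3)).
Proof.
move=> Ha He Hs; split; last by rewrite det3 !mxE /=; field: Ha He Hs.
apply/matrixP; apply: forall3; apply: forall3;
by rewrite !mxE sum3 !mxE /= ?mulr1n ?mulr0n; field: Ha He Hs.
Qed.

(** Seen along a diagonal of the cube, only weights 0 and 3 survive. For c and s the cosine and sine
    of an angle, the weight 3 part depends on three times that angle. *)
Lemma quart_threefold (a e c s : R) :
  a ^+ 2 = 6 -> e ^+ 2 = 3 -> s ^+ 2 = 1 - c ^+ 2 ->
  let f := mx3 (a / 3 * c) (a / 3 * (- c / 2 - e / 2 * s)) (a / 3 * (- c / 2 + e / 2 * s))
           (a / 3 * s) (a / 3 * (e / 2 * c - s / 2)) (a / 3 * (- e / 2 * c - s / 2))
           (e / 3) (e / 3) (e / 3) in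
  [/\ quart f o0 o0 o0 o0 = - (1 / 10), quart f o0 o0 o0 o1 = 0,
      quart f o0 o0 o0 o2 = a * e / 18 * (c ^+ 3 - 3 * c * s ^+ 2),
      quart f o0 o0 o1 o2 = a * e / 18 * (3 * c ^+ 2 * s - s ^+ 3) &
  [/\ quart f o0 o0 o2 o2 = 2 / 15, quart f o0 o1 o2 o2 = 0,
      quart f o0 o2 o2 o2 = 0, quart f o1 o2 o2 o2 = 0 &
      quart f o2 o2 o2 o2 = - (4 / 15)]].
Proof.
move=> Ha He Hs f; rewrite quart_SO3; last exact: SO3_threefold.
by do ?split; rewrite !sum3 !mxE /=; field: Ha He Hs.
Qed.

Lemma threefold_form T (p1 p2 t : R) : H4 T ->
  p1 ^+ 2 + p2 ^+ 2 = 25 / 32 * t ^+ 2 ->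
  [/\ T o0 o0 o0 o0 = 3 / 8 * t, T o0 o0 o0 o1 = 0,
      T o0 o0 o0 o2 = p1, T o0 o0 o1 o2 = p2 &
  [/\ T o0 o0 o2 o2 = - (t / 2), T o0 o1 o2 o2 = 0,
      T o0 o2 o2 o2 = 0, T o1 o2 o2 o2 = 0 & T o2 o2 o2 o2 = t]] ->
  exists c f, SO3 f /\ T = scale4 c (quart f).
Proof.
move=> hT E5 [F0000 F0001 F0002 F0012 [F0022 F0122 F0222 F1222 F2222]].
have [t0|t0] := eqVneq t 0.
  exists 0, 1%:M; split; first exact: SO3_1.
  have /andP[/eqP p10 /eqP p20] : (p1 == 0) && (p2 == 0).
    by rewrite -(sqrf_eq0 p1) -(sqrf_eq0 p2) -paddr_eq0 ?sqr_ge0 // E5 t0 expr0n mulr0.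
  apply: H4_ext => //; first by apply/H4_scale4/H4_quart/SO3_1.
  by rewrite /scale4 !mul0r; do ?split; lra.
pose e : R := Num.sqrt 3; pose a : R := Num.sqrt 6.
have He : e ^+ 2 = 3 by rewrite sqr_sqrtr //; lra.
have Ha : a ^+ 2 = 6 by rewrite sqr_sqrtr //; lra.
(* [tau] scales the component -4/15 of [quart] along the axis to [t]; [kap] is the resulting factor
   of the weight 3 part. *)
pose tau := - (15 / 4) * t; pose kap := tau * (a * e / 18).
have kap2 : kap ^+ 2 = 25 / 32 * t ^+ 2.
  by rewrite /kap /tau; field: Ha He.
have kap0 : kap != 0.
  by rewrite -sqrf_eq0 kap2 mulf_neq0 ?sqrf_eq0 //; lra.
(* The phase (p1, p2) / [kap] has modulus 1, and its cube root gives the rotation about the third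
   axis. *)
have [|c [s [cs EX EY]]] := @unit_cube_root R (p1 / kap) (p2 / kap).
  by rewrite !exprMn -mulrDl E5 -kap2 exprVn mulfV ?sqrf_eq0.
have Hs : s ^+ 2 = 1 - c ^+ 2 by rewrite -cs; ring.
have SOf := SO3_threefold Ha He Hs; have := quart_threefold Ha He Hs.
rewrite EX EY /=; set f := mx3 _ _ _ _ _ _ _ _ _.
move=> [G0000 G0001 G0002 G0012 [G0022 G0122 G0222 G1222 G2222]].
exists tau, f; split=> //; apply: H4_ext => //.
  by apply/H4_scale4/H4_quart.
rewrite /scale4 G0000 G0001 G0002 G0012 G0022 G0122 G0222 G1222 G2222.
have K p : tau * (a * e / 18 * (p / kap)) = p by rewrite mulrA -/kap mulrCA mulfV ?mulr1.
by rewrite !K; do ?split; rewrite /tau; lra.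
Qed.

Lemma scalar_d2_normal_form T (lam : R) : H4 T -> d2 T = lam%:M ->
  T o0 o0 o0 o0 - 6 * T o0 o0 o1 o1 + T o1 o1 o1 o1 = 0 ->
  T o0 o0 o0 o1 = T o0 o1 o1 o1 ->
  exists c f, SO3 f /\ T = scale4 c (quart f).
Proof.
move=> hT dT n1 n2; have [sT _] := hT.
have [a1 a2 a3 [a4 a5 a6]] := H4_trace hT.
(* Each letter isolates one weight: the shifts in [q1], [p1], [p2] remove the lower weights. As [n1]
   and [n2] annihilate weight 4, seven parameters determine [T]. *)
pose t := T o2 o2 o2 o2; pose r1 := T o0 o2 o2 o2; pose r2 := T o1 o2 o2 o2.
pose q1 := T o0 o0 o2 o2 + t / 2; pose q2 := T o0 o1 o2 o2.
pose p1 := T o0 o0 o0 o2 + 3 / 4 * r1; pose p2 := T o0 o0 o1 o2 + r2 / 4.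
have F0000 : T o0 o0 o0 o0 = 3 / 8 * t - q1 by rewrite /q1 /t; lra.
have F1111 : T o1 o1 o1 o1 = 3 / 8 * t + q1 by rewrite /q1 /t; lra.
have F0011 : T o0 o0 o1 o1 = t / 8 by rewrite /t; lra.
have F0001 : T o0 o0 o0 o1 = - q2 / 2 by rewrite /q2; lra.
have F0111 : T o0 o1 o1 o1 = - q2 / 2 by rewrite /q2; lra.
have F0022 : T o0 o0 o2 o2 = q1 - t / 2 by rewrite /q1; lra.
have F1122 : T o1 o1 o2 o2 = - q1 - t / 2 by rewrite /q1 /t; lra.
have F0002 : T o0 o0 o0 o2 = p1 - 3 / 4 * r1 by rewrite /p1; lra.
have F0112 : T o0 o1 o1 o2 = - p1 - r1 / 4 by rewrite /p1 /r1; lra.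
have F0012 : T o0 o0 o1 o2 = p2 - r2 / 4 by rewrite /p2; lra.
have F1112 : T o1 o1 o1 o2 = - p2 - 3 / 4 * r2 by rewrite /p2 /r2; lra.
have F2222 : T o2 o2 o2 o2 = t by [].
have F0222 : T o0 o2 o2 o2 = r1 by [].
have F1222 : T o1 o2 o2 o2 = r2 by [].
have F0122 : T o0 o1 o2 o2 = q2 by [].
have D i j : d2 T i j = lam *+ (i == j) by rewrite dT mxE.
have D00 := D o0 o0; have D11 := D o1 o1; have D22 := D o2 o2.
have D01 := D o0 o1; have D02 := D o0 o2; have D12 := D o1 o2.
move: D00 D11 D22 D01 D02 D12.
rewrite !d2E // !sum3 !(sort_rules sT) F2222 F0222 F1222 F0122 F0000 F1111 F0011 F0001
  F0111 F0022 F1122 F0002 F0112 F0012 F1112 /= ?mulr1n ?mulr0n.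
move: F0000 F0001 F0022 F0002 F0012 F2222 F0222 F1222 F0122.
clear F1111 F0011 F0111 F1122 F0112 F1112 a1 a2 a3 a4 a5 a6 n1 n2 D.
clearbody t r1 r2 q1 q2 p1 p2.
move=> F0000 F0001 F0022 F0002 F0012 F2222 F0222 F1222 F0122 D00 D11 D22 D01 D02 D12.
(* All equations are now linear in the monomials of free variables. The diagonal of [d2] gives this
   one; [D00] - [D11] and [D01] give the weight 2 equation, [D02] and [D12] the weight 1
   equation. *)
have E5 : p1 ^+ 2 + p2 ^+ 2 = q1 ^+ 2 + q2 ^+ 2 + 17 / 16 * (r1 ^+ 2 + r2 ^+ 2)
    + 25 / 32 * t ^+ 2 by lra.
have [] : [/\ q1 = 0, q2 = 0, r1 = 0 & r2 = 0].
  by apply: (weights_vanish (p1 := p1) (p2 := p2) (t := t)); lra.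
clear D00 D11 D22 D01 D02 D12 => Q1 Q2 R1 R2.
move: F0000 F0001 F0022 F0002 F0012 F0222 F1222 F0122 E5.
rewrite {}Q1 {}Q2 {}R1 {}R2 => F0000 F0001 F0022 F0002 F0012 F0222 F1222 F0122 E5.
have {}E5 : p1 ^+ 2 + p2 ^+ 2 = 25 / 32 * t ^+ 2 by lra.
by apply: (@threefold_form T p1 p2 t) => //; do ?split; lra.
Qed.

(** The [i]-th diagonal entry of [d2 T] is the sum of the squares of all components with first index
    [i]. *)
Lemma d2_eq0 T : H4 T -> d2 T = 0 -> T = fun _ _ _ _ => 0.
Proof.
move=> [sT _] dT; apply: funext => i; apply: funext => j.
apply: funext => k; apply: funext => l.
have nn a b c : 0 <= T i a b c * T i a b c by rewrite -expr2 sqr_ge0.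
have z (F : 'I_3 -> R) : (forall n, 0 <= F n) -> \sum_n F n = 0 -> forall n, F n = 0.
  by move=> F0 S n; apply: (psumr_eq0P _ S).
have := congr1 (fun M : 'M[R]_3 => M i i) dT; rewrite d2E // mxE => E.
have {}E := z _ _ E j; have {}E := z _ _ (E _) k; have {}E := z _ _ (E _ _) l.
apply/eqP; rewrite -sqrf_eq0 expr2 E // => ?; do ?(apply: sumr_ge0 => ? _); exact: nn.
Qed.

(** Undoing the rotation of [null_axis] writes [T] as a multiple of a rotated [quart 1%:M]; the
    factor is nonzero because d_2 is, so the symmetry group is a conjugate of the cube group. *)
Lemma scalar_d2_cubic T (lam : R) : H4 T -> d2 T = lam%:M -> d2 T != 0 ->
  cubic (symgroup4 T).
Proof.
move=> hT dT dT0; have [g SOg [n1 n2]] := null_axis hT.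
have dgT : d2 (act4 g T) = lam%:M by rewrite d2_act4 // dT SO3_act2_scalar.
have [c [f [SOf E]]] := scalar_d2_normal_form (act4_H4 SOg hT) dgT n1 n2.
have [/mulmx1C g'g _] := SOg.
have {E}TE : T = scale4 c (act4 (g^T *m f) (quart 1%:M)).
  by rewrite act4M act4_quart1 -act4_scale4 -E -act4M g'g act4_1.
have c0 : c != 0.
  apply: contraNneq dT0 => c0; apply/eqP/matrixP => i j.
  rewrite (d2E _ _ (proj1 hT)) mxE TE c0 /scale4.
  by do 3 (rewrite big1 // => ? _); rewrite !mul0r.
have SOgf : SO3 (g^T *m f) by apply: SO3M => //; exact: SO3_tr.
by exists (g^T *m f) => //; rewrite TE symgroup4_scale4 // symgroup4_act4 // symgroup4_quart1.
Qed.

End CubicForm.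

(** * The cycle of implications (1) => (3) => (2) => (1) *)

Theorem theorem9p3 (R : realType) (H : tensor4 R) (hH : H4 H) :
  (isotropic (symgroup2_family (Cov2 H)) <->
     ((d2 H != 0 /\ cubic (symgroup4 H)) \/ (d2 H = 0 /\ isotropic (symgroup4 H))))
  /\
  (((d2 H != 0 /\ cubic (symgroup4 H)) \/ (d2 H = 0 /\ isotropic (symgroup4 H))) <->
     isotropic (symgroup2 (d2 H))).
Proof.
have i13 : isotropic (symgroup2_family (Cov2 H)) -> isotropic (symgroup2 (d2 H)).
  move=> /isotropicP E; apply/isotropicP/seteqP; split=> [g []//|g].
  rewrite -E => -[SOg fix_g]; split=> // _ ->; apply: fix_g.
  by exists (@d2 R); split=> //; exact: d2_equivariant.
have i32 : isotropic (symgroup2 (d2 H)) ->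
    (d2 H != 0 /\ cubic (symgroup4 H)) \/ (d2 H = 0 /\ isotropic (symgroup4 H)).
  move=> /isotropic_symgroup2_scalar [c E].
  have [d0|d0] := eqVneq (d2 H) 0; last by left; split=> //; exact: scalar_d2_cubic E d0.
  right; split=> //; apply/isotropicP/seteqP; split=> [g []//|g SOg]; split=> //.
  rewrite (d2_eq0 hH d0); apply: funext => i; apply: funext => j.
  apply: funext => k; apply: funext => l.
  by rewrite /act4; do 4 (rewrite big1 // => ? _); rewrite mulr0.
have i21 : (d2 H != 0 /\ cubic (symgroup4 H)) \/ (d2 H = 0 /\ isotropic (symgroup4 H)) ->
    isotropic (symgroup2_family (Cov2 H)).
  case=> [[_ [f SOf E]]|[_ /isotropicP E]].
    by apply: (Cov2_isotropic hH SOf) => k cube_k; rewrite E; exists k.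
  apply: (Cov2_isotropic hH (SO3_1 R)) => k [SOk _].
  by rewrite E mul1mx trmx1 mulmx1.
by split; split; auto.
Qed.
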